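(* Let $n$ be a multiple of $k$. Then $\mathrm{Comet}(n,k)$ has mixing time $t_{\rm mix}=O(1)$ and diameter $k$. Furthermore, any algorithm requires at least $\Omega\left(\left(\frac nk\right)^{k-1}\right)$ queries to $\mathcal{O}^\pi$ and $\Omega(n)$ queries to $\overrightarrow{\mathcal{O}}$ to distinguish between $G=\mathrm{Comet}(n,k)$ and $\tilde G=\mathrm{Comet}(2n,2k)$.
   Context: $\mathrm{Comet}(n,k)$ (for $k\mid n$) is the directed graph with centres $v_1,\dots,v_k$ forming a directed cycle $(v_i,v_{i+1})$ for $1\le i<k$ and $(v_k,v_1)$; for each $\ell\in[k]$ directed edges $(v_\ell,v_{\ell,j})$ for $j\in[n/k-1]$; and for every leaf $v_{\ell,j}$ an edge $(v_{\ell,j},v_1)$. Lazy random walk on a directed graph: stay with probability $1/2$, otherwise move to a uniformly random out-neighbour; $\pi$ its stationary distribution; $t_{\rm mix}=\max_u\min\{t\ge1:\|p^t(u,\cdot)-\pi\|_{TV}\le e^{-1}\}$ with $\|\mu-\nu\|_{TV}=\frac12\sum_x|\mu(x)-\nu(x)|$. Oracles use the consecutive labelling $\ell$ (each newly revealed node gets the smallest unused natural number). $\mathcal{O}^\pi$: each query returns $(\ell(v),\deg^+(v))$ for $v$ drawn independently from $\pi$. $\overrightarrow{\mathcal{O}}$: graph stored with out-adjacency lists in arbitrary order; it keeps a set $S$ of revealed nodes; on $\mathsf{init}$ it picks a node $v$, sets $S=\{v\}$, returns $(\ell(v),\deg^+(v))$; on $(l,i,\mathsf{out})$, if $v\in S$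 has $\ell(v)=l$ and $i\le\deg^+(v)$, it returns $(\ell(u),\deg^+(u))$ for $u$ the $i$-th out-neighbour of $v$ and adds $u$ to $S$, otherwise $\mathsf{null}$; queries $(l,i,\mathsf{in})$ always return $\mathsf{null}$. Each query costs one unit.
   Formalization: The mixing-time and diameter claims are proved for k < n (for n = k the graph is a directed cycle and both fail); the diameter is k+1, not k (it is k only for n = 2, k = 1), while the largest distance from v_1 is k. *)

(* Defs.v *)
From HB Require Import structures.
From mathcomp Require Export all_boot all_order all_algebra.
From mathcomp Require Export all_classical all_reals all_analysis.

Set Implicit Arguments.
Unset Strict Implicit.
Unset Printing Implicit Defensive.

Import Order.TTheory GRing.Theory Num.Theory.
Local Open Scope classical_set_scope.
Local Open Scope ring_scope.

Section Digraph.
Variables (R : realType) (V : finType) (e : rel V).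

Definition outdeg (v : V) : nat := #|e v|.

(* The value is +oo when v is not reachable from u. *)
Definition dist (u v : V) : \bar R :=
  ereal_inf [set (size s)%:R%:E | s in [set s : seq V | path e u s /\ last u s = v]].

Definition eccentricity (u : V) : \bar R :=
  \big[maxe/-oo%E]_(v : V) dist u v.

Definition diameter : \bar R :=
  \big[maxe/-oo%E]_(u : V) eccentricity u.

Definition lazy_step (u v : V) : R :=
  2^-1 * (u == v)%:R + 2^-1 * ((e u v)%:R / (outdeg u)%:R).

Fixpoint lazy_walk (t : nat) (u v : V) : R :=
  if t is t'.+1 then \sum_(w : V) lazy_walk t' u w * lazy_step w v
  else (u == v)%:R.

Definition is_stationary (pi : {ffun V -> R}) : Prop :=
  [/\ forall v, 0 <= pi v,
      \sum_(v : V) pi v = 1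
    & forall v, \sum_(u : V) pi u * lazy_step u v = pi v].

(* The default value, used only if there is no stationary distribution, is at
   total variation distance 1/2 > exp(-1) from every probability distribution;
   a bound on tmix below therefore cannot come from it. *)
Definition stationary : {ffun V -> R} :=
  xget [ffun=> 0] [set pi | is_stationary pi].

Definition tv_dist (mu nu : V -> R) : R :=
  2^-1 * \sum_(x : V) `|mu x - nu x|.

(* An infimum over an empty set of times is +oo; over a nonempty one it is a
   minimum. *)
Definition tmix : \bar R :=
  \big[maxe/-oo%E]_(u : V)
    ereal_inf [set t%:R%:E | t in
      [set t : nat | (0 < t)%N /\ tv_dist (lazy_walk t u) stationary <= expR (-1)]].

End Digraph.

(* inl i is the centre v_(i+1), and inr (i, j) is the leaf v_(i+1, j+1). *)
Definition comet_vertex (n k : nat) : finType :=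
  ('I_k + 'I_k * 'I_(n %/ k).-1)%type.

Definition comet (n k : nat) : rel (comet_vertex n k) := fun u v =>
  match u, v with
  | inl i, inl j => j == ordS i
  | inl i, inr (l, _) => l == i
  | inr _, inl j => val j == 0%N
  | inr _, inr _ => false
  end.
Arguments comet : clear implicits.

(* Some (l, d) is a node with label l and out-degree d; None is null. *)
Definition answer : Type := option (nat * nat).

(* Given the answers so far (oldest first): the next query, or the output. *)
Definition strategy (Q : Type) : Type := seq answer -> Q + bool.

(* A randomised algorithm draws a deterministic one from an arbitrary
   probability space. *)
Record algorithm (R : realType) (Q : Type) := Algorithm {
  seed_display : measure_display;
  seed : measurableType seed_display;
  seed_law : probability seed R;
  strategy_of : seed -> strategy Q;
  measurable_strategy_of : forall (h : seq answer) (a : Q + bool),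
    measurable [set w | strategy_of w h = a]
}.
Arguments strategy_of {R Q} _ _ _.

(* The output reached with at most q queries; None if q queries do not
   suffice. *)
Fixpoint run (Q S : Type) (oracle : S -> Q -> S * answer) (alg : strategy Q)
    (q : nat) (s : S) (h : seq answer) : option bool :=
  match alg h with
  | inr b => Some b
  | inl x =>
      if q is q'.+1 then
        let: (s', a) := oracle s x in run oracle alg q' s' (rcons h a)
      else None
  end.

(* A label table lists the labelled nodes in order of revelation; the label of
   a node is its index there. *)
Definition reveal (V : eqType) (tbl : seq V) (v : V) : seq V :=
  if v \in tbl then tbl else rcons tbl v.

Definition reveal_answer (V : finType) (e : rel V) (tbl : seq V) (v : V) : answer :=
  Some (index v (reveal tbl v), outdeg e v).

Section StationaryOracle.
Variables (R : realType) (V : finType) (e : rel V).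

(* State: the samples not yet consumed, and the label table. *)
Definition pi_oracle (s : seq V * seq V) (_ : unit) : (seq V * seq V) * answer :=
  if s.1 is v :: samples then
    ((samples, reveal s.2 v), reveal_answer e s.2 v)
  else (s, None).

Definition pi_output_prob (A : algorithm R unit) (q : nat) (b : bool) : \bar R :=
  (\sum_(x : q.-tuple V)
    (\prod_(i < q) stationary R e (tnth x i))%:E *
    seed_law A [set w | run pi_oracle (strategy_of A w) q
                          (val x, [::]) [::] = Some b])%E.

End StationaryOracle.

Definition pi_distinguishes (R : realType) (V W : finType) (e : rel V) (f : rel W)
    (p : R) (A : algorithm R unit) (q : nat) : Prop :=
  (p%:E <= pi_output_prob e A q true)%E /\ (p%:E <= pi_output_prob f A q false)%E.

Inductive direction := Out | In.

Inductive query := Init | Neighbour (l i : nat) (dir : direction).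

Section OutOracle.
Variables (R : realType) (V : finType) (e : rel V).

Definition adjacency_lists (adj : V -> seq V) : Prop :=
  forall v, perm_eq (adj v) (enum (e v)).

Record out_state := OutState {
  labels : seq V;
  revealed : {set V};
  inits : nat
}.

(* pick j is the node picked on the (j+1)-st init query. *)
Definition out_oracle (adj : V -> seq V) (pick : nat -> V)
    (s : out_state) (x : query) : out_state * answer :=
  match x with
  | Init =>
      let v := pick (inits s) in
      (OutState (reveal (labels s) v) [set v]%SET (inits s).+1,
       reveal_answer e (labels s) v)
  | Neighbour l i Out =>
      if onth (labels s) l is Some v then
        if (v \in revealed s) && (0 < i <= outdeg e v)%N then
          let u := nth v (adj v) i.-1 in
          (OutState (reveal (labels s) u) (u |: revealed s)%SET (inits s),
           reveal_answer e (labels s) u)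
        else (s, None)
      else (s, None)
  | Neighbour _ _ In => (s, None)
  end.

Definition out_output_prob (adj : V -> seq V) (pick : nat -> V)
    (A : algorithm R query) (q : nat) (b : bool) : \bar R :=
  seed_law A [set w | run (out_oracle adj pick) (strategy_of A w) q
                        (OutState [::] finset.set0 0) [::] = Some b].

(* The order of the adjacency lists and the nodes picked on init are
   arbitrary, so the algorithm has to succeed for each of them. *)
Definition out_success (p : R) (A : algorithm R query) (q : nat) (b : bool) : Prop :=
  forall (adj : V -> seq V) (pick : nat -> V), adjacency_lists adj ->
    (p%:E <= out_output_prob adj pick A q b)%E.

End OutOracle.

Definition out_distinguishes (R : realType) (V W : finType) (e : rel V) (f : rel W)
    (p : R) (A : algorithm R query) (q : nat) : Prop :=
  out_success e p A q true /\ out_success f p A q false.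

(* Main.v *)
(* Write m = n/k, and let the height of the centre v_i be i - 1 and that of a
   leaf of v_i be i. Every edge raises the height by at most 1 and the
   stationary weight of a vertex is proportional to m^-height.

   Mixing: two lazy steps lead from anywhere to v_1 with probability at least
   1/8, so (Doeblin) the distance to stationarity shrinks by 7/8 every two steps.

   Stationary samples: Comet(n,k) embeds in Comet(2n,2k) as the first k
   centres with their leaves, and the second stationary law restricted to the
   image is the first one divided by 1 + m^-k; hence q samples tell the graphs
   apart with advantage at most q m^-k.

   Out-queries: let every init query return v_1 and hide the edge from v_i to the
   next centre at position h_i of its list. The graphs answer alike until the
   k-th such edge is found. A deterministic algorithm and the set of times at
   which it finds the k edges determine h, so at most C(q,k) <= (e q/k)^k of the
   m^k choices of h are bad; averaging over h gives q = Omega(n). *)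

Require Import Defs.
From mathcomp Require Import all_boot all_order all_algebra.
From mathcomp Require Import all_classical all_reals all_analysis.
From mathcomp Require Import measurable_realfun zify ring lra.
Import Order.TTheory GRing.Theory Num.Theory.
Local Open Scope ring_scope.
Set Implicit Arguments.
Unset Strict Implicit.
Unset Printing Implicit Defensive.

(** * Mixing *)

Section LazyWalk.
Variables (R : realType) (V : finType) (e : rel V).
Hypothesis outdeg_gt0 : forall v, (0 < outdeg e v)%N.

Lemma lazy_step_ge0 u v : 0 <= lazy_step R e u v.
Proof. by rewrite addr_ge0 ?mulr_ge0 ?divr_ge0 ?invr_ge0. Qed.

Lemma sum_delta (f : V -> R) v : \sum_u f u * (u == v)%:R = f v.
Proof.
rewrite (bigD1 v) //= eqxx mulr1 big1 ?addr0 // => u /negPf ->.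
by rewrite mulr0.
Qed.

(** Separates the half that stays from the inflow along edges, so that stationarity reduces to flow
    balance. *)
Lemma sum_lazy_step (f : V -> R) v :
  \sum_u f u * lazy_step R e u v =
  2^-1 * f v + 2^-1 * \sum_u f u * ((e u v)%:R / (outdeg e u)%:R).
Proof.
rewrite -[in RHS](sum_delta f v) !mulr_sumr -big_split /=.
by apply: eq_bigr => u _; rewrite /lazy_step; ring.
Qed.

Lemma lazy_step_sum1 u : \sum_v lazy_step R e u v = 1.
Proof.
rewrite /lazy_step big_split /= -!mulr_sumr -mulr_suml.
have -> : \sum_v (u == v)%:R = 1 :> R.
  by rewrite (bigD1 u) //= eqxx big1 ?addr0 // => v; rewrite eq_sym => /negPf ->.
rewrite -natr_sum (eq_bigr (fun v => if e u v then 1%N else 0%N)); last first.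
  by move=> v _; case: (e u v).
rewrite -big_mkcond sum1_card -/(outdeg e u).
by rewrite divff ?pnatr_eq0 -?lt0n //; lra.
Qed.

Lemma sum_lazy_walk t u : \sum_v lazy_walk R e t u v = 1.
Proof.
elim: t => [|t IH] /=.
  by rewrite (bigD1 u) //= eqxx big1 ?addr0 // => v; rewrite eq_sym => /negPf ->.
rewrite exchange_big /= -[RHS]IH; apply: eq_bigr => w _.
by rewrite -mulr_sumr lazy_step_sum1 mulr1.
Qed.

Lemma lazy_walk2 u v :
  lazy_walk R e 2 u v = \sum_w lazy_step R e u w * lazy_step R e w v.
Proof.
apply: eq_bigr => w _; congr (_ * _) => /=.
rewrite (bigD1 u) //= eqxx mul1r big1 ?addr0 // => x.
by rewrite eq_sym => /negPf ->; rewrite mul0r.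
Qed.

Lemma sum_lazy_walk2 (f : V -> R) v :
  \sum_w f w * lazy_walk R e 2 w v =
  \sum_x (\sum_w f w * lazy_step R e w x) * lazy_step R e x v.
Proof.
under [RHS]eq_bigr do rewrite mulr_suml.
rewrite [RHS]exchange_big; apply: eq_bigr => w _.
by rewrite lazy_walk2 mulr_sumr; apply: eq_bigr => x _; rewrite mulrA.
Qed.

Lemma lazy_walk_ge0 t u v : 0 <= lazy_walk R e t u v.
Proof.
elim: t v => [|t IH] v //=; apply: sumr_ge0 => w _.
by rewrite mulr_ge0 ?lazy_step_ge0.
Qed.

(* Subtracting the common mass d at v0 from every row of the kernel does not
   change its action on functions of sum zero. *)
Lemma doeblin_contraction (K : V -> V -> R) (v0 : V) (d : R) (f : V -> R) :
  (forall u v, 0 <= K u v) -> (forall u, \sum_v K u v = 1) ->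
  (forall u, d <= K u v0) -> \sum_u f u = 0 ->
  \sum_v `|\sum_u f u * K u v| <= (1 - d) * \sum_u `|f u|.
Proof.
move=> K0 K1 Kd f0.
pose L u v := K u v - d * (v == v0)%:R.
have L0 u v : 0 <= L u v.
  by rewrite /L; case: eqP => [->|_]; rewrite ?mulr1 ?mulr0 ?subr0 ?subr_ge0.
have L1 u : \sum_v L u v = 1 - d.
  by rewrite sumrB K1 (sum_delta (fun=> d)).
have -> : \sum_v `|\sum_u f u * K u v| = \sum_v `|\sum_u f u * L u v|.
  apply: eq_bigr => v _; congr `|_|.
  rewrite /L; under [RHS]eq_bigr do rewrite mulrBr.
  by rewrite sumrB -mulr_suml f0 mul0r subr0.
apply: (@le_trans _ _ (\sum_v \sum_u `|f u| * L u v)).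
  apply: ler_sum => v _; apply: le_trans (ler_norm_sum _ _ _) _.
  by apply: ler_sum => u _; rewrite normrM (ger0_norm (L0 _ _)).
rewrite exchange_big /= mulr_sumr; apply: ler_sum => u _.
by rewrite -mulr_sumr L1 mulrC.
Qed.

(** The walk minus [pi] has total zero and, [pi] being invariant, evolves by the two-step kernel, so
    each pair of steps contracts it by [1 - d]. *)
Lemma tv_lazy_walk_le (pi : {ffun V -> R}) (v0 : V) (d : R) (s : nat) (u : V) :
  is_stationary e pi -> d <= 1 -> (forall w, d <= lazy_walk R e 2 w v0) ->
  tv_dist (lazy_walk R e s.*2 u) pi <= (1 - d) ^+ s.
Proof.
move=> [pi0 pi1 piS] d1 dP.
(* The factor 2 bounds the initial $\ell^1$ distance of two probability laws and cancels the one
   half in [tv_dist]. *)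
suff : \sum_x `|lazy_walk R e s.*2 u x - pi x| <= 2 * (1 - d) ^+ s.
  by rewrite /tv_dist; lra.
elim: s => [|s IH].
  rewrite expr0 mulr1 /=.
  apply: (@le_trans _ _ (\sum_x ((u == x)%:R + pi x))).
    by apply: ler_sum => x _; rewrite (le_trans (ler_normB _ _)) // !ger0_norm.
  by rewrite big_split /= pi1 (sum_lazy_walk 0 u).
have piSS v : \sum_w pi w * lazy_walk R e 2 w v = pi v.
  by rewrite sum_lazy_walk2; under eq_bigr do rewrite piS; exact: piS.
rewrite doubleS.
under eq_bigr => x _.
  rewrite /= -sum_lazy_walk2 -(piSS x) -sumrB.
  under eq_bigr do rewrite -mulrBl.
  over.
apply: le_trans (doeblin_contraction _ _ dP _) _.
- exact: lazy_walk_ge0.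
- exact: sum_lazy_walk.
- by rewrite sumrB sum_lazy_walk pi1 subrr.
rewrite exprS mulrCA ler_wpM2l //; lra.
Qed.

(** Time 16 is eight double steps, and $(7/8)^8 \le e^{-1}$ because $1 - 1/8 \le e^{-1/8}$. *)
Lemma tmix_le (pi : {ffun V -> R}) (v0 : V) :
  is_stationary e pi -> (forall w, 8^-1 <= lazy_walk R e 2 w v0) ->
  (tmix R e <= 16%:R%:E)%E.
Proof.
move=> piS dP; apply/bigmax_leP; split => [|u _]; first exact: leNye.
apply: ereal_inf_lbound; exists 16%N => //; split => //.
(* The existence of [pi] rules out the default value of [xget]. *)
have st : is_stationary e (stationary R e).
  by rewrite /stationary; case: xgetP => [|/(_ pi)].
apply: (le_trans (@tv_lazy_walk_le _ v0 8^-1 8 u st _ dP)); first by lra.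
have -> : - 1 = 8%:R * - 8^-1 :> R by lra.
rewrite expRM_natl; apply: lerXn2r; rewrite ?nnegrE ?expR_ge0 //; first lra.
exact: expR_ge1Dx.
Qed.
End LazyWalk.

(** * Stationary law and mixing time of the comet *)

Section Comet.
Variables (R : realType) (n k : nat).
Hypotheses (k_gt0 : (0 < k)%N) (n_gt0 : (0 < n)%N) (k_dvd : (k %| n)%N).

Local Notation m := (n %/ k)%N.
Local Notation V := (comet_vertex n k).
Local Notation G := (comet n k).

Definition centre1 : V := inl (Ordinal k_gt0).

(** This is the distance from [centre1], and also the exponent in the stationary weight. *)
Definition height (v : V) : nat :=
  match v with inl i => val i | inr (i, _) => (val i).+1 end.

Lemma quotient_gt0 : (0 < m)%N.
Proof. by rewrite divn_gt0 // dvdn_leq. Qed.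

Lemma ordS_lt (i : 'I_k) : (i.+1 < k)%N -> val (ordS i) = i.+1.
Proof. by move=> lt_ik; rewrite /= modn_small. Qed.

Lemma ordS_last (i : 'I_k) : i.+1 = k -> val (ordS i) = 0%N.
Proof. by move=> eq_ik; rewrite /= eq_ik modnn. Qed.

(** There are one successor and $m-1$ leaves; for $k=1$ the successor is the centre itself, and this
    loop counts as an edge. *)
Lemma outdeg_centre i : outdeg G (inl i) = m.
Proof.
rewrite /outdeg -sum1_card big_sumType /=.
rewrite (eq_bigl (fun j => j == ordS i)) // big_pred1_eq.
rewrite (eq_bigl (fun p : 'I_k * 'I_m.-1 => (p.1 == i) && true)); last first.
  by move=> [l j]; rewrite andbT.
rewrite -(pair_big (fun l => l == i) (fun=> true) (fun _ _ => 1%N)) /=.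
by rewrite big_pred1_eq sum1_card card_ord add1n prednK ?quotient_gt0.
Qed.

Lemma outdeg_leaf x : outdeg G (inr x) = 1%N.
Proof.
rewrite /outdeg -sum1_card big_sumType /= [X in (_ + X)%N]big_pred0 // addn0.
rewrite (eq_bigl (fun j => j == Ordinal k_gt0)) ?big_pred1_eq //.
Qed.

Lemma comet_outdeg_gt0 v : (0 < outdeg G v)%N.
Proof. by case: v => v; rewrite ?outdeg_centre ?outdeg_leaf ?quotient_gt0. Qed.

Lemma sum_comet (f : V -> R) :
  \sum_v f v = \sum_i f (inl i) + \sum_(i < k) \sum_(j < m.-1) f (inr (i, j)).
Proof.
by rewrite big_sumType /= pair_big; congr (_ + _); apply: eq_bigr => -[].
Qed.

(** Inflow has three cases. A leaf or a later centre is fed by a single centre, which sends out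
    $1/m$ of its weight; [centre1] is fed by the last centre and by all leaves. *)
Lemma inflow_leaf (f : V -> R) i j :
  \sum_u f u * ((G u (inr (i, j)))%:R / (outdeg G u)%:R) = f (inl i) / m%:R.
Proof.
rewrite sum_comet [X in _ + X]big1 ?addr0; last first.
  by move=> l _; rewrite big1 // => p _; rewrite mul0r mulr0.
rewrite (bigD1 i) //= eqxx outdeg_centre mul1r big1 ?addr0 // => l.
by rewrite eq_sym => /negPf ->; rewrite mul0r mulr0.
Qed.

Lemma inflow_centre (f : V -> R) (i j : 'I_k) : val j = i.+1 ->
  \sum_u f u * ((G u (inl j))%:R / (outdeg G u)%:R) = f (inl i) / m%:R.
Proof.
move=> eq_ji; have lt_ik : (i.+1 < k)%N by rewrite -eq_ji ltn_ord.
rewrite sum_comet [X in _ + X]big1 ?addr0; last first.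
  by move=> l _; rewrite big1 // => p _; rewrite /= eq_ji mul0r mulr0.
have ej : ordS i = j by apply: val_inj; rewrite [LHS]ordS_lt.
rewrite (bigD1 i) //= ej eqxx outdeg_centre mul1r big1 ?addr0 // => l neq_li.
rewrite -ej (inj_eq (@ordS_inj _)) eq_sym (negPf neq_li).
by rewrite mul0r mulr0.
Qed.

Lemma inflow_centre1 (f : V -> R) (l : 'I_k) : l.+1 = k ->
  \sum_u f u * ((G u centre1)%:R / (outdeg G u)%:R) =
  f (inl l) / m%:R + \sum_(i < k) \sum_(j < m.-1) f (inr (i, j)).
Proof.
move=> eq_lk; rewrite sum_comet; congr (_ + _); last first.
  apply: eq_bigr => i _; apply: eq_bigr => j _.
  by rewrite outdeg_leaf /= divr1 mulr1.
have ej : ordS l = Ordinal k_gt0 by apply: val_inj; rewrite [LHS]ordS_last.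
rewrite (bigD1 l) //= ej eqxx outdeg_centre mul1r big1 ?addr0 // => i neq_il.
rewrite -ej (inj_eq (@ordS_inj _)) eq_sym (negPf neq_il).
by rewrite mul0r mulr0.
Qed.

Definition comet_weight (v : V) : R := m%:R ^- height v.

(** The leaves of a centre together carry $(m-1)/m$ of its weight; the weights of the centres form a
    geometric series. *)
Definition comet_mass : R := (1 + (m.-1)%:R / m%:R) * \sum_(i < k) m%:R ^- i.

Lemma sum_comet_weight : \sum_v comet_weight v = comet_mass.
Proof.
rewrite sum_comet /comet_mass mulrDl mul1r; congr (_ + _).
rewrite mulr_sumr; apply: eq_bigr => i _.
by rewrite /comet_weight /= sumr_const card_ord exprS invfM -[LHS]mulr_natl mulrA.
Qed.

Lemma comet_mass_gt0 : 0 < comet_mass.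
Proof.
rewrite mulr_gt0 ?ltr_pwDl //.
rewrite (bigD1 (Ordinal k_gt0)) //= expr0 invr1 ltr_pwDl // sumr_ge0 //.
Qed.

(** A centre's weight $m^{-j}$ splits equally among one centre and $m-1$ leaves, so the weight still
    on the cycle plus that already shed to leaves stays 1. *)
Lemma comet_weight_telescope (j : nat) :
  m%:R ^- j + \sum_(i < j) \sum_(p < m.-1) m%:R ^- i.+1 = 1 :> R.
Proof.
have m0 : m%:R != 0 :> R by rewrite pnatr_eq0 -lt0n quotient_gt0.
elim: j => [|j IH]; first by rewrite big_ord0 addr0 expr0 invr1.
rewrite -[RHS]IH big_ord_recr /= addrCA addrC; congr (_ + _).
rewrite sumr_const card_ord -mulrS prednK ?quotient_gt0 // exprS invfM.
by rewrite -[LHS]mulr_natl mulrA divff // mul1r.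
Qed.

Lemma comet_weight_stationary v :
  \sum_u comet_weight u * lazy_step R G u v = comet_weight v.
Proof.
rewrite sum_lazy_step -mulrDr.
suff -> : \sum_u comet_weight u * ((G u v)%:R / (outdeg G u)%:R) = comet_weight v.
  by lra.
case: v => [[[|j] lt_jk]|[i j]].
- have lt_lk : (k.-1 < k)%N by rewrite prednK.
  rewrite (_ : Ordinal lt_jk = Ordinal k_gt0); last exact: val_inj.
  rewrite (@inflow_centre1 _ (Ordinal lt_lk)) /=; last by rewrite prednK.
  (* The last centre contributes $m^{-k}$, so balance at [centre1] is the telescoping identity for
     $j = k$. *)
  rewrite /comet_weight /= -invfM -exprSr prednK //.
  by rewrite comet_weight_telescope expr0 invr1.
- rewrite (@inflow_centre _ (Ordinal (ltnW lt_jk))) //.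
  by rewrite /comet_weight /= -invfM -exprSr.
- by rewrite inflow_leaf /comet_weight /= -invfM -exprSr.
Qed.

(** For uniqueness, flow balance propagates the value at [centre1] along the cycle and to the
    leaves; total mass one then fixes that value. *)
Lemma comet_stationaryP (pi : {ffun V -> R}) :
  is_stationary G pi <-> forall v, pi v = comet_weight v / comet_mass.
Proof.
have Z0 := comet_mass_gt0.
split=> [[pi0 pi1 piS] v|piE]; last first.
  split=> [v||v].
  - by rewrite piE divr_ge0 ?(ltW Z0) // invr_ge0 exprn_ge0.
  - under eq_bigr do rewrite piE.
    by rewrite -mulr_suml sum_comet_weight divff ?gt_eqF.
  - under eq_bigr do rewrite piE mulrAC.
    by rewrite -mulr_suml comet_weight_stationary piE.
have flow u : \sum_w pi w * ((G w u)%:R / (outdeg G w)%:R) = pi u.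
  by have := piS u; rewrite sum_lazy_step; lra.
have centreE i (lt_ik : (i < k)%N) :
    pi (inl (Ordinal lt_ik)) = comet_weight (inl (Ordinal lt_ik)) * pi centre1.
  elim: i lt_ik => [|i IH] lt_ik.
    rewrite /comet_weight /= expr0 invr1 mul1r; congr (pi (inl _)).
    exact: val_inj.
  rewrite -flow (@inflow_centre _ (Ordinal (ltnW lt_ik))) // IH.
  by rewrite /comet_weight /= exprSr invfM mulrAC.
have piE u : pi u = comet_weight u * pi centre1.
  case: u => [[i lt_ik]|[i j]]; first exact: centreE.
  rewrite -flow inflow_leaf; case: i => i lt_ik; rewrite centreE.
  by rewrite /comet_weight /= exprSr invfM mulrAC.
rewrite piE; congr (_ * _); move: pi1.
under eq_bigr do rewrite piE.
rewrite -mulr_suml sum_comet_weight => massE.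
by rewrite -[RHS]mulr1 -massE mulKf ?gt_eqF.
Qed.

Lemma comet_stationaryE v : stationary R G v = comet_weight v / comet_mass.
Proof.
rewrite /stationary; case: xgetP => [pi -> /comet_stationaryP ->//|].
move/(_ [ffun v => comet_weight v / comet_mass]) => [].
by apply/comet_stationaryP => u; rewrite ffunE.
Qed.

(** A leaf stays and then moves to [centre1] with probability 1/4. A centre goes to one of its
    leaves with probability $(m-1)/(2m) \ge 1/4$, and from there to [centre1] with probability
    1/2. *)
Lemma comet_tmix : (1 < m)%N -> (tmix R G <= 16%:R%:E)%E.
Proof.
move=> m_gt1.
have st : is_stationary G [ffun v : V => comet_weight v / comet_mass].
  by apply/comet_stationaryP => u; rewrite ffunE.
apply: (tmix_le comet_outdeg_gt0 (v0 := centre1) st) => w; rewrite lazy_walk2.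
have step_leaf x : 2^-1 <= lazy_step R G (inr x) centre1.
  by rewrite /lazy_step outdeg_leaf /=; lra.
have step0 := @lazy_step_ge0 R _ G.
case: w => [i|x]; last first.
  rewrite (bigD1 (inr x)) //= ler_wpDr ?sumr_ge0 // => [u _|].
    by rewrite mulr_ge0 ?step0.
  have : 2^-1 <= lazy_step R G (inr x) (inr x).
    by rewrite /lazy_step eqxx /=; lra.
  have := step_leaf x; set a := lazy_step _ _ _ _; set b := lazy_step _ _ _ _.
  by nra.
rewrite sum_comet ler_wpDl ?sumr_ge0 // => [u _|]; first by rewrite mulr_ge0.
rewrite (bigD1 i) //= ler_wpDr ?sumr_ge0 // => [l _|].
  by rewrite sumr_ge0 // => j _; rewrite mulr_ge0.
apply: (@le_trans _ _ (\sum_(j < m.-1) (2^-1 / m%:R) * 2^-1)); last first.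
  apply: ler_sum => j _; apply: ler_pM => //.
  by rewrite /lazy_step /= eqxx outdeg_centre mulr0 add0r mul1r.
rewrite sumr_const card_ord -[leRHS]mulr_natl.
have m0 : (0 : R) < m%:R by rewrite ltr0n; lia.
have mE : m%:R = m.-1%:R + 1 :> R by rewrite natr1 prednK //; lia.
have m1 : 1 <= m.-1%:R :> R by rewrite ler1n; lia.
have : 2^-1 <= m.-1%:R / m%:R :> R by rewrite ler_pdivlMr //; lra.
by clear; move: (m.-1%:R : R) (m%:R^-1 : R) => a b; lra.
Qed.
End Comet.

(** * Diameter *)

Section Diameter.
Variables (R : realType) (V : finType) (e : rel V).

Lemma dist_le u s d : path e u s -> (size s <= d)%N ->
  (dist R e u (last u s) <= d%:R%:E)%E.
Proof.
move=> us sd; apply: (@le_trans _ _ (size s)%:R%:E); last first.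
  by rewrite lee_fin ler_nat.
by apply: ereal_inf_lbound; exists s.
Qed.

Lemma dist_ge u v d :
  (forall s, path e u s -> last u s = v -> (d <= size s)%N) ->
  (d%:R%:E <= dist R e u v)%E.
Proof.
move=> dP; apply: le_ereal_inf_tmp => _ [s [us lv] <-].
by rewrite lee_fin ler_nat dP.
Qed.

Lemma eccentricity_eq u d : (forall v, dist R e u v <= d%:R%:E)%E ->
  (exists v, d%:R%:E <= dist R e u v)%E -> eccentricity R e u = d%:R%:E.
Proof.
move=> led [v ged]; apply/eqP; rewrite eq_le; apply/andP; split.
  by apply/bigmax_leP; split => [|w _] //; exact: leNye.
by apply: le_trans ged _; exact: le_bigmax.
Qed.

Lemma diameter_eq d : (forall u v, dist R e u v <= d%:R%:E)%E ->
  (exists u v, d%:R%:E <= dist R e u v)%E -> diameter R e = d%:R%:E.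
Proof.
move=> led [u [v ged]]; apply/eqP; rewrite eq_le; apply/andP; split.
  apply/bigmax_leP; split => [|w _]; first exact: leNye.
  by apply/bigmax_leP; split => [|x _] //; exact: leNye.
apply: le_trans ged _; apply: le_trans (le_bigmax _ _ u).
exact: le_bigmax.
Qed.
End Diameter.

Section CometDiameter.
Variables (R : realType) (n k : nat).
Hypotheses (k_gt0 : (0 < k)%N) (m_gt1 : (1 < n %/ k)%N).

Local Notation m := (n %/ k)%N.
Local Notation V := (comet_vertex n k).
Local Notation G := (comet n k).
Local Notation v1 := (centre1 n k_gt0).

Lemma height_le (v : V) : (height v <= k)%N.
Proof. by case: v => [i|[i j]] /=; [exact: ltnW|exact: ltn_ord]. Qed.

Lemma height_edge (u v : V) : G u v -> (height v <= (height u).+1)%N.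
Proof.
case: u v => [i|x] [j|[l p]] //=; last by move/eqP->.
  (* [ordS] is the successor modulo [k], and wrapping round only lowers the height. *)
  move/eqP->; exact: leq_mod.
by move/eqP->.
Qed.

Lemma height_path (u : V) s : path G u s -> (height (last u s) <= height u + size s)%N.
Proof.
elim: s u => [|v s IH] u /=; first by rewrite addn0.
case/andP=> /height_edge uv /IH us.
by rewrite addnS -addSn (leq_trans us) // leq_add2r.
Qed.

Lemma path_centres (i j : 'I_k) : (i <= j)%N ->
  exists s, [/\ path G (inl i : V) s, last (inl i : V) s = inl j & size s = (j - i)%N].
Proof.
move: {-1}(j - i)%N (erefl (j - i)%N) => d.
elim: d i => [|d IH] i dE le_ij.
  by exists [::]; split => //=; congr inl; apply: val_inj => /=; lia.
have lt_ik : (i.+1 < k)%N by have := ltn_ord j; lia.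
have := ordS_lt lt_ik => /= oi.
have [||s [us lu ss]] := IH (ordS i); rewrite /= ?oi; try lia.
by exists (inl (ordS i) :: s); rewrite /= eqxx us lu ss; split => //; lia.
Qed.

Lemma path_from_centre (i : 'I_k) (v : V) : (i < height v)%N ->
  exists s, [/\ path G (inl i : V) s, last (inl i : V) s = v & size s = (height v - i)%N].
Proof.
case: v => [j|[j p]] /= lt_ij; first exact: path_centres (ltnW _).
have [s [us lu ss]] := path_centres lt_ij.
exists (rcons s (inr (j, p))); rewrite rcons_path us lu last_rcons size_rcons ss /=.
by split => //; lia.
Qed.

Lemma path_from_centre1 (v : V) :
  exists s, [/\ path G v1 s, last v1 s = v & size s = height v].
Proof.
have [v0|v_gt0] := posnP (height v); last first.
  have [s [us lu ss]] := @path_from_centre (Ordinal k_gt0) v v_gt0.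
  by exists s; rewrite ss subn0.
exists [::]; split => //; case: v v0 => [i|[i j]] //= i0.
by congr inl; apply: val_inj.
Qed.

(** The farthest vertex is a leaf of the last centre: it has height $k$, and an edge gains at most
    one level. *)
Lemma comet_eccentricity : eccentricity R G v1 = k%:R%:E.
Proof.
apply: eccentricity_eq => [v|].
  have [s [us lu ss]] := path_from_centre1 v.
  by rewrite -lu; apply: dist_le => //; rewrite ss height_le.
have lt_lk : (k.-1 < k)%N by rewrite prednK.
have lt_0m : (0 < m.-1)%N by lia.
exists (inr (Ordinal lt_lk, Ordinal lt_0m)); apply: dist_ge => s us lu.
by have := height_path us; rewrite lu /= prednK.
Qed.

Lemma comet_dist_le (u v : V) : (dist R G u v <= k.+1%:R%:E)%E.
Proof.
have [s [vs lv ss]] := path_from_centre1 v; have v_le := height_le v.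
case: u => [i|x].
  have [lt_iv|le_vi] := ltnP i (height v).
    have [t [us lu st]] := path_from_centre lt_iv.
    by rewrite -lu; apply: dist_le => //; rewrite st (leq_trans (leq_subr _ _)) // leqW.
  (* The target is not above the centre, so the path detours through a leaf to [centre1]: its length
     is [height v + 2], with [height v] at most $i \le k-1$. *)
  have lt_0m : (0 < m.-1)%N by lia.
  have <- : last (inl i : V) [:: inr (i, Ordinal lt_0m), v1 & s] = v by [].
  apply: dist_le; first by rewrite /= eqxx.
  by rewrite /= ss !ltnS (leq_ltn_trans le_vi).
have <- : last (inr x : V) (v1 :: s) = v by [].
by apply: dist_le => //=; rewrite ss.
Qed.

(** A nonempty path out of a leaf first enters [centre1] and then has to climb $k$ levels;
    distinctness excludes the empty path. *)
Lemma leaf_dist_ge (x y : 'I_k * 'I_m.-1) : x != y -> y.1.+1 = k ->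
  (k.+1%:R%:E <= dist R G (inr x) (inr y))%E.
Proof.
move=> neq_xy yk; apply: dist_ge => -[|v s] /=.
  by move=> _ [xy]; rewrite xy eqxx in neq_xy.
case: v => [i|//] /andP[/eqP i0 /height_path] us lu.
by move: us; rewrite lu /= i0; case: y yk {neq_xy lu} => y p /= ->; lia.
Qed.

(** The value $k+1$ is attained from another leaf to a leaf of the last centre. Only for $n=2$ is
    there just one leaf, and then the diameter is $k=1$. *)
Lemma comet_diameter : (k %| n)%N ->
  diameter R G = (if n == 2%N then k else k.+1)%:R%:E.
Proof.
move=> k_dvd; have lt_0m : (0 < m.-1)%N by lia.
have nE : n = (m * k)%N by rewrite divnK.
have lt_lk : (k.-1 < k)%N by rewrite prednK.
pose y : 'I_k * 'I_m.-1 := (Ordinal lt_lk, Ordinal lt_0m).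
have yk : y.1.+1 = k by rewrite /= prednK.
case: ifPn => [n2|n2].
  have k1 : k = 1%N by nia.
  have m2 : m = 2%N by nia.
  apply: diameter_eq => [u v|]; last first.
    exists v1, (inr y); apply: dist_ge => s us lu.
    by have := height_path us; rewrite lu /= prednK.
  have i0 (i : 'I_k) : i = Ordinal k_gt0 by apply: val_inj => /=; have := ltn_ord i; lia.
  have [s [vs lv ss]] := path_from_centre1 v; have v_le := height_le v.
  case: u => [i|x].
    by rewrite (i0 i) -lv; apply: dist_le => //; rewrite ss.
  case: v lv ss v_le => [i|z] lv ss v_le.
    have <- : last (inr x : V) (v1 :: s) = inl i by [].
    by apply: dist_le => //=; rewrite ss /= (i0 i).
  have -> : x = z.
    case: x z {lv ss v_le} => [a b] [c d]; rewrite (i0 a) (i0 c); congr pair.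
    by apply: val_inj; have := ltn_ord b; have := ltn_ord d => /=; lia.
  have <- : last (inr z : V) [::] = inr z by [].
  by apply: dist_le.
apply: diameter_eq => [u v|]; first exact: comet_dist_le.
suff [x neq_xy] : exists x, x != y by exists (inr x), (inr y); exact: leaf_dist_ge.
(* A leaf other than [y]: one of the first centre if $k>1$, otherwise a second leaf of the only
   centre, which exists since $n \ne 2$. *)
have [k1|k1] := eqVneq k 1%N; last first.
  exists (Ordinal k_gt0, Ordinal lt_0m); rewrite xpair_eqE -val_eqE /=.
  by apply/nandP; left; lia.
have lt_1m : (1 < m.-1)%N by move: m_gt1; rewrite k1 divn1; lia.
exists (Ordinal lt_lk, Ordinal lt_1m).
by rewrite xpair_eqE negb_and -[X in _ || ~~ X]val_eqE /= orbT.
Qed.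
End CometDiameter.

(** * Sampling from the stationary distribution *)

Section RunProbability.
Variables (R : realType) (Q S : Type) (oracle : S -> Q -> S * answer).
Variable A : algorithm R Q.
Hypothesis countableQ : countable [set: Q]%classic.
Local Open Scope classical_set_scope.

(** The event splits by the first move into an output, or a query followed by a shorter run;
    countability of the queries keeps the union measurable. *)
Lemma measurable_run q s h b :
  measurable [set w | run oracle (strategy_of A w) q s h = Some b].
Proof.
elim: q s h => [|q IH] s h.
  have -> : [set w | run oracle (strategy_of A w) 0 s h = Some b] =
            [set w | strategy_of A w h = inr b].
    apply/seteqP; split => w /=; case: (strategy_of A w h) => [x|c] //.
      by case=> ->.
    by case=> ->.
  exact: measurable_strategy_of.
have -> : [set w | run oracle (strategy_of A w) q.+1 s h = Some b] =
    [set w | strategy_of A w h = inr b] `|`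
    \bigcup_x ([set w | strategy_of A w h = inl x] `&`
      [set w | run oracle (strategy_of A w) q (oracle s x).1
                 (rcons h (oracle s x).2) = Some b]).
  apply/seteqP; split => w /=.
    case E : (strategy_of A w h) => [x|c]; last by case=> ->; left.
    case O : (oracle s x) => [s' a] wb; right; exists x => //=; split => //.
    by rewrite O.
  case=> [->//|[x _ [/= -> ]]].
  by case: (oracle s x).
apply: measurableU; first exact: measurable_strategy_of.
apply: countable_bigcupT_measurable => // x.
by apply: measurableI; [exact: measurable_strategy_of|exact: IH].
Qed.

Definition output_prob q s b : R :=
  fine (seed_law A [set w | run oracle (strategy_of A w) q s [::] = Some b]).

Lemma output_probE q s b :
  seed_law A [set w | run oracle (strategy_of A w) q s [::] = Some b] =
  (output_prob q s b)%:E.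
Proof.
rewrite fineK // ge0_fin_numE ?measure_ge0 //.
by rewrite (le_lt_trans (probability_le1 _ (measurable_run _ _ _ _))) ?ltry.
Qed.

Lemma output_prob_ge0 q s b : 0 <= output_prob q s b.
Proof. by rewrite fine_ge0. Qed.

Lemma output_prob_sum_le1 q s : output_prob q s true + output_prob q s false <= 1.
Proof.
rewrite -lee_fin EFinD -!output_probE -measureU.
- by apply: probability_le1; apply: measurableU; exact: measurable_run.
- exact: measurable_run.
- exact: measurable_run.
- by apply/seteqP; split => w //= [->].
Qed.
End RunProbability.

Section StationarySampling.
Variables (R : realType) (V W : finType) (e : rel V) (f : rel W) (phi : V -> W).
Hypothesis phi_inj : injective phi.
Hypothesis phi_outdeg : forall v, outdeg f (phi v) = outdeg e v.

(** Injectivity is local because the map from nodes to vertices used later is injective only on part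
    of its domain. *)
Lemma map_reveal (T U : eqType) (g : T -> U) tbl v :
  {in rcons tbl v &, injective g} ->
  reveal (map g tbl) (g v) = map g (reveal tbl v).
Proof.
move=> g_inj; rewrite /reveal; have -> : (g v \in map g tbl) = (v \in tbl).
  apply/mapP/idP => [[x xt /g_inj ->] //|vt]; last by exists v.
    by rewrite mem_rcons inE eqxx.
  by rewrite mem_rcons inE xt orbT.
by case: ifP; rewrite // map_rcons.
Qed.

(** Labels record only which samples coincide, a pattern that an injective [phi] keeps, and the
    out-degrees agree as well. *)
Lemma run_pi_oracle_map (alg : strategy unit) q x tbl h :
  run (pi_oracle f) alg q (map phi x, map phi tbl) h =
  run (pi_oracle e) alg q (x, tbl) h.
Proof.
elim: q x tbl h => [|q IH] x tbl h //=.
case: (alg h) => // -[]; case: x => [|v x]; rewrite /pi_oracle /=.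
  exact: (IH [::]).
rewrite map_reveal; last by move=> ? ? _ _; exact: phi_inj.
rewrite -IH /reveal_answer phi_outdeg map_reveal ?index_map //.
by move=> ? ? _ _; exact: phi_inj.
Qed.
End StationarySampling.

Lemma countable_unit : countable [set: unit]%classic.
Proof. by apply/countable_injP; exists (fun=> 0%N) => -[] []. Qed.

Section PiOutputProb.
Variables (R : realType) (A : algorithm R unit) (q : nat).

Definition pi_output (V : finType) (e : rel V) (x : q.-tuple V) b : R :=
  output_prob (pi_oracle e) A q (val x, [::]) b.

Lemma pi_output_probE (V : finType) (e : rel V) b :
  pi_output_prob e A q b =
  (\sum_(x : q.-tuple V) \prod_(i < q) stationary R e (tnth x i) * pi_output e x b)%:E.
Proof.
rewrite -sumEFin; apply: eq_bigr => x _.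
by rewrite (output_probE _ _ countable_unit) -EFinM.
Qed.

Lemma sum_prod_tuple (V : finType) (f : V -> R) :
  \sum_(x : q.-tuple V) \prod_(i < q) f (tnth x i) = (\sum_v f v) ^+ q.
Proof.
rewrite -[in RHS](card_ord q) -prodr_const bigA_distr_bigA /=.
rewrite (reindex (fun g : {ffun 'I_q -> V} => [tuple g i | i < q])) /=.
  by apply: eq_bigr => g _; apply: eq_bigr => i _; rewrite tnth_mktuple.
exists (fun x : q.-tuple V => [ffun i => tnth x i]) => g _.
  by apply/ffunP => i; rewrite ffunE tnth_mktuple.
by apply/eq_from_tnth => i; rewrite tnth_mktuple ffunE.
Qed.
End PiOutputProb.

(* On samples that all lie in the image of phi the two oracles give the same
   answers. *)
Lemma pi_distinguishes_le (R : realType) (V W : finType) (e : rel V) (f : rel W)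
    (phi : V -> W) (d p : R) (A : algorithm R unit) (q : nat) :
  injective phi -> (forall v, outdeg f (phi v) = outdeg e v) ->
  is_stationary e (stationary R e) -> is_stationary f (stationary R f) ->
  0 <= d <= 1 ->
  (forall v, (1 - d) * stationary R e v <= stationary R f (phi v)) ->
  0 < p -> pi_distinguishes e f p A q -> p * (2 - q%:R * d) <= 1.
Proof.
move=> phi_inj phi_deg [e0 e1 _] [f0 f1 _] /andP[d0 d1] ef p0 [].
rewrite !pi_output_probE !lee_fin.
set PT := \sum_(x : q.-tuple V) _; set PF := \sum_(x : q.-tuple W) _ => pT pF.
(* [QT] is the probability of the wrong output [true] on the second graph. *)
pose QT := \sum_(y : q.-tuple W)
  \prod_(i < q) stationary R f (tnth y i) * pi_output A f y true.
have prod0 (y : q.-tuple W) : 0 <= \prod_(i < q) stationary R f (tnth y i).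
  by apply: prodr_ge0.
have QTF : QT + PF <= 1.
  rewrite /QT /PF -big_split /= -[leRHS](expr1n _ q) -[in leRHS]f1 -sum_prod_tuple.
  apply: ler_sum => y _; rewrite -mulrDr ler_piMr //.
  exact: (output_prob_sum_le1 _ _ countable_unit).
(* Keep only the samples inside the image of [phi]: the answers are the same there, and each of the
   $q$ weights is at least $1-d$ times the original one. *)
have QTP : (1 - d) ^+ q * PT <= QT.
  pose phit (x : q.-tuple V) := map_tuple phi x.
  have phit_inj : injective phit.
    by move=> x y /(congr1 val) /= /(inj_map phi_inj) /val_inj.
  apply: (@le_trans _ _ (\sum_(y in phit @: [set: q.-tuple V])
    \prod_(i < q) stationary R f (tnth y i) * pi_output A f y true)); last first.
    rewrite big_mkcond; apply: ler_sum => y _; case: ifP => // _.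
    by rewrite mulr_ge0 ?output_prob_ge0.
  rewrite big_imset /=; last by move=> ? ? _ _; exact: phit_inj.
  rewrite /PT mulr_sumr; rewrite [leRHS](eq_bigl xpredT); last by move=> x; rewrite inE.
  apply: ler_sum => x _.
  have -> : pi_output A f (phit x) true = pi_output A e x true.
    have runE w : run (pi_oracle f) (strategy_of A w) q (val (phit x), [::]) [::] =
        run (pi_oracle e) (strategy_of A w) q (val x, [::]) [::].
      exact: (run_pi_oracle_map phi_inj phi_deg _ _ _ [::]).
    by congr fine; congr (seed_law A _); apply/funext => w; rewrite /mkset runE.
  rewrite mulrA ler_wpM2r ?output_prob_ge0 //.
  rewrite -[X in _ ^+ X](card_ord q) -prodr_const -big_split /=.
  apply: ler_prod => i _; rewrite tnth_map ef andbT mulr_ge0 //; lra.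
(* Bernoulli's inequality. *)
have bern : 1 - q%:R * d <= (1 - d) ^+ q.
  elim: (q) => [|r IH]; first by rewrite mul0r subr0 expr0.
  rewrite exprS -natr1; have : 0 <= r%:R :> R by [].
  by move: (r%:R) IH => a IH a0; nra.
have dq : 0 <= (1 - d) ^+ q by rewrite exprn_ge0 // subr_ge0.
(* Hence [p * (1 - q * d) <= QT <= 1 - PF <= 1 - p]. *)
have : (1 - d) ^+ q * p <= (1 - d) ^+ q * PT by rewrite ler_wpM2l.
by move: ((1 - d) ^+ q) bern QTP dq => a bern QTP dq h; nra.
Qed.

(** * Embedding of Comet(n,k) in Comet(2n,2k) *)

Section CometEmbedding.
Variables (R : realType) (n k : nat).
Hypotheses (k_gt0 : (0 < k)%N) (n_gt0 : (0 < n)%N) (k_dvd : (k %| n)%N).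

Lemma le_double : (k <= 2 * k)%N. Proof. exact: leq_pmull. Qed.

Lemma eq_quotient : (n %/ k = 2 * n %/ (2 * k))%N. Proof. by rewrite divnMl. Qed.

(** Out-degrees are preserved but not all edges: $v_k$ leads to $v_1$ in one graph and to $v_{k+1}$
    in the other. The cast is there because the leaf index types agree only propositionally. *)
Definition comet_embed (v : comet_vertex n k) : comet_vertex (2 * n) (2 * k) :=
  match v with
  | inl i => inl (widen_ord le_double i)
  | inr (i, j) => inr (widen_ord le_double i, cast_ord (congr1 predn eq_quotient) j)
  end.

Lemma comet_embed_inj : injective comet_embed.
Proof.
move=> [i|[i j]] [i'|[i' j']] //= [].
  by move=> ii; congr inl; apply: val_inj.
by move=> ii jj; congr (inr (_, _)); apply: val_inj.
Qed.

Let k2_gt0 : (0 < 2 * k)%N. Proof. by rewrite muln_gt0. Qed.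
Let n2_gt0 : (0 < 2 * n)%N. Proof. by rewrite muln_gt0. Qed.
Let k2_dvd : (2 * k %| 2 * n)%N. Proof. by rewrite dvdn_pmul2l. Qed.

Lemma comet_embed_outdeg v :
  outdeg (comet (2 * n) (2 * k)) (comet_embed v) = outdeg (comet n k) v.
Proof.
case: v => [i|[i j]] /=; last by rewrite !outdeg_leaf.
by rewrite !outdeg_centre // -eq_quotient.
Qed.

Lemma comet_embed_stationary v :
  (1 - (n %/ k)%:R ^- k) * stationary R (comet n k) v <=
  stationary R (comet (2 * n) (2 * k)) (comet_embed v).
Proof.
have Z0 := comet_mass_gt0 R n k_gt0; have Z1 := comet_mass_gt0 R (2 * n) k2_gt0.
have m1 : 0 < (n %/ k)%:R :> R by rewrite ltr0n quotient_gt0.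
have x0 : 0 <= (n %/ k)%:R ^- k :> R by rewrite invr_ge0 exprn_ge0 // ltW.
rewrite !comet_stationaryE //.
have -> : comet_weight R (comet_embed v) = comet_weight R v.
  by rewrite /comet_weight -eq_quotient; case: v => [i|[i j]].
(* The geometric sum of $2k$ terms is that of $k$ terms plus $m^{-k}$ times the same sum. *)
have massE : comet_mass R (2 * n) (2 * k) = (1 + (n %/ k)%:R ^- k) * comet_mass R n k.
  rewrite /comet_mass -eq_quotient mulrCA; congr (_ * _).
  rewrite mul2n -addnn.
  rewrite big_split_ord /= mulrDl mul1r mulr_sumr; congr (_ + _).
  by apply: eq_bigr => i _; rewrite exprD invfM.
rewrite massE [X in _ <= _ * X]invfM [leRHS]mulrCA [leRHS]mulrC ler_pdivlMr ?ltr_pwDl //.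
have : 0 <= comet_weight R v / comet_mass R n k.
  by rewrite divr_ge0 ?ltW // invr_gt0 exprn_gt0.
move: (comet_weight R v / _) x0 => w; move: (_ ^- k) => x x0 w0.
(* With $x=m^{-k}$ the claim is $(1-x)(1+x) \le 1$, scaled by [w]. *)
have := mulr_ge0 w0 (mulr_ge0 x0 x0); lra.
Qed.
End CometEmbedding.

(** Solves $p(2 - qd) \le 1$ for $q$, with $d=m^{-k}$. *)
Lemma stationary_query_bound (R : realType) (p : R) (n k : nat)
    (A : algorithm R unit) (q : nat) :
  0 < p -> (0 < k)%N -> (0 < n)%N -> (k %| n)%N ->
  pi_distinguishes (comet n k) (comet (2 * n) (2 * k)) p A q ->
  (2 - p^-1) * (n %/ k)%:R ^+ k <= q%:R.
Proof.
move=> p0 k0 n0 kn dis.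
have m1 : 1 <= (n %/ k)%:R :> R by rewrite ler1n quotient_gt0.
have m0 : 0 < (n %/ k)%:R ^+ k :> R by rewrite exprn_gt0 // (lt_le_trans _ m1).
have d01 : 0 <= ((n %/ k)%:R ^- k : R) <= 1.
  by rewrite invr_ge0 ltW //= invf_le1 // exprn_ege1.
have stat n' k' : (0 < k')%N -> (0 < n')%N -> (k' %| n')%N ->
    is_stationary (comet n' k') (stationary R (comet n' k')).
  by move=> *; apply/comet_stationaryP => // v; exact: comet_stationaryE.
have k20 : (0 < 2 * k)%N by rewrite muln_gt0.
have n20 : (0 < 2 * n)%N by rewrite muln_gt0.
have kn2 : (2 * k %| 2 * n)%N by rewrite dvdn_pmul2l.
have := pi_distinguishes_le (@comet_embed_inj n k)
  (comet_embed_outdeg k0 n0 kn) (stat _ _ k0 n0 kn) (stat _ _ k20 n20 kn2)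
  d01 (comet_embed_stationary R k0 n0 kn) p0 dis.
rewrite -ler_pdivlMl // mulr1 => h.
by rewrite -ler_pdivlMr //; lra.
Qed.

(** * Out-neighbour queries *)

Lemma countable_query : countable [set: query]%classic.
Proof.
pose code x : option (nat * nat * bool) :=
  match x with
  | Init => None
  | Neighbour l i Out => Some (l, i, true)
  | Neighbour l i In => Some (l, i, false)
  end.
apply/countable_injP; exists (pickle \o code) => x y _ _ /= /(pcan_inj pickleK).
by case: x y => [|l i []] [|l' i' []] //= [-> ->].
Qed.

(* A node met by an algorithm that starts at the first centre: inl i is the
   centre v_(i+1), and inr (i, p) is the leaf at position p of the adjacency
   list of that centre. *)
Definition node : Type := (nat + nat * nat)%type.

(** * Counting the hidden positions that a run can find *)

Section HiddenOracle.
Variables (m k : nat).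
Implicit Types s : seq node * seq node.

Definition node_outdeg (x : node) : nat := if x is inl _ then m else 1%N.

(* h i is the position of the edge to the next centre in the list of v_(i+1). *)
Definition node_next (h : nat -> nat) (x : node) (p : nat) : node :=
  match x with
  | inl i => if p == h i then inl i.+1 else inr (i, p)
  | inr _ => inl 0%N
  end.

Definition node_reveal s (r : seq node) (x : node) : (seq node * seq node) * answer :=
  ((reveal s.1 x, x :: r), Some (index x (reveal s.1 x), node_outdeg x)).

(* The state consists of the label table and the revealed nodes. *)
Definition hidden_oracle (h : nat -> nat) s (x : query) :
    (seq node * seq node) * answer :=
  match x with
  | Init => node_reveal s [::] (inl 0%N)
  | Neighbour l i Out =>
      if onth s.1 l is Some v then
        if (v \in s.2) && (0 < i <= node_outdeg v)%N then
          node_reveal s s.2 (node_next h v i.-1)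
        else (s, None)
      else (s, None)
  | Neighbour _ _ In => (s, None)
  end.

(** [inl k] stands for $v_{k+1}$, the first node on which the two comets can disagree; the test is
    whether it enters the label table within [q] queries. *)
Fixpoint finds_centre (h : nat -> nat) (alg : strategy query) (q : nat) s
    (hist : seq answer) : bool :=
  (inl k \in s.1) ||
  match alg hist with
  | inr _ => false
  | inl x =>
      if q is q'.+1 then
        let: (s', a) := hidden_oracle h s x in
        finds_centre h alg q' s' (rcons hist a)
      else false
  end.

Lemma mem_reveal (T : eqType) (tbl : seq T) x y :
  (y \in reveal tbl x) = (y == x) || (y \in tbl).
Proof.
rewrite /reveal; case: ifP => [xt|_]; last by rewrite mem_rcons inE.
by case: eqP => // ->.
Qed.

(** The default 0 extends [h] to all naturals; in the larger comet it places the edges of the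
    centres after $v_k$. *)
Definition hidden_at (h : {ffun 'I_k -> 'I_m}) (i : nat) : nat :=
  if insub i is Some o then val (h o) else 0%N.

Lemma hidden_at_ord (h : {ffun 'I_k -> 'I_m}) (i : 'I_k) : hidden_at h i = h i.
Proof. by rewrite /hidden_at valK. Qed.

Definition agree_below j (h h' : {ffun 'I_k -> 'I_m}) : bool :=
  [forall i : 'I_k, (i < j)%N ==> (h i == h' i)].

Lemma agree_belowP j (h h' : {ffun 'I_k -> 'I_m}) :
  reflect (forall i : 'I_k, (i < j)%N -> h i = h' i) (agree_below j h h').
Proof.
apply: (iffP forallP) => [H i lt_ij|H i]; first exact/eqP/(implyP (H i)).
by apply/implyP => /H ->.
Qed.

(** A query reads [h] only at the centre it starts from, and a labelled centre other than [inl j]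
    has index below [j], where the two functions agree. *)
Lemma hidden_oracle_agree j (h h' : {ffun 'I_k -> 'I_m}) s l i :
  (j <= k)%N -> agree_below j h h' -> onth s.1 l != Some (inl j) ->
  (forall c, inl c \in s.1 -> (c <= j)%N) ->
  hidden_oracle (hidden_at h) s (Neighbour l i Out) =
  hidden_oracle (hidden_at h') s (Neighbour l i Out).
Proof.
move=> le_jk /agree_belowP hh' neq_j below /=.
case E : (onth s.1 l) => [[c|x]|] //; case: ifP => // _.
have lt_cj : (c < j)%N.
  rewrite ltn_neqAle below ?andbT; last first.
    by apply/onthP; exists l.
  by apply: contraNneq neq_j => <-; rewrite E.
have lt_ck := leq_trans lt_cj le_jk.
rewrite /node_next -[c]/(val (Ordinal lt_ck)) !hidden_at_ord.
by rewrite hh'.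
Qed.

Lemma card_agree_below (h0 : {ffun 'I_k -> 'I_m}) (P : pred {ffun 'I_k -> 'I_m}) :
  (#|[set h | agree_below k h0 h & P h]| <= 1)%N.
Proof.
rewrite -(cards1 h0); apply/subset_leq_card/fintype.subsetP => h.
rewrite !inE => /andP[/agree_belowP hh _].
by apply/eqP/ffunP => i; rewrite hh.
Qed.

(* Each query that finds a new centre fixes one more value of h, so Pascal's
   recurrence bounds the number of possible h. *)
Lemma card_finds_centre (alg : strategy query) q j (h0 : {ffun 'I_k -> 'I_m}) s hist :
  (j <= k)%N -> (forall c, inl c \in s.1 -> (c <= j)%N) ->
  (#|[set h : {ffun 'I_k -> 'I_m} | agree_below j h0 h &
       finds_centre (hidden_at h) alg q s hist]| <= 'C(q, k - j))%N.
Proof.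
elim: q j h0 s hist => [|q IH] j h0 s hist le_jk below;
  (have [->|neq_jk] := eqVneq j k; first by rewrite subnn bin0 card_agree_below).
  rewrite (_ : [set _ | _ & _] = finset.set0) ?cards0 //.
  apply/setP => h; rewrite !inE /=; apply/negbTE/nandP; right.
  rewrite negb_or; apply/andP; split; last by case: (alg hist).
  by apply/negP => /below; lia.
have lt_jk : (j < k)%N by lia.
have notk : (inl k \in s.1) = false by apply/negP => /below; lia.
have mono : ('C(q, k - j) <= 'C(q.+1, k - j))%N by apply: leq_bin2l.
(* If all remaining [h] give the same reply, the query only uses up budget: the induction hypothesis
   applies with the same [j]. *)
have same s' a : (forall h, agree_below j h0 h ->
      forall x, alg hist = inl x -> hidden_oracle (hidden_at h) s x = (s', a)) ->
    (forall c, inl c \in s'.1 -> (c <= j)%N) ->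
    (#|[set h : {ffun 'I_k -> 'I_m} | agree_below j h0 h &
       finds_centre (hidden_at h) alg q.+1 s hist]| <= 'C(q, k - j))%N.
  move=> hs' below'; apply: leq_trans (IH j h0 s' (rcons hist a) le_jk below').
  apply/subset_leq_card/fintype.subsetP => h; rewrite !inE /= notk /= => /andP[hh].
  rewrite hh /=; case E : (alg hist) => [x|//].
  by rewrite (hs' h hh x E).
case E : (alg hist) => [[|l i dir]|b]; last first.
- by apply: leq_trans (same s None _ _) mono => // h _ x; rewrite E.
- case: dir E => E; last first.
    by apply: leq_trans (same s None _ _) mono => // h _ x; rewrite E => -[<-].
  (* Only a query at [inl j] can depend on a value of [h] that is not yet fixed. *)
  have [El|neq_l] := eqVneq (onth s.1 l) (Some (inl j)); last first.
    pose t := hidden_oracle (hidden_at h0) s (Neighbour l i Out).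
    apply: leq_trans (same t.1 t.2 _ _) mono.
      move=> h hh x; rewrite E => -[<-].
      by rewrite -(hidden_oracle_agree _ le_jk hh neq_l below) -surjective_pairing.
    rewrite /t /= => c; case O : (onth s.1 l) => [v|]; last exact: below.
    case: ifP => _; last exact: below.
    rewrite /= mem_reveal => /orP[|]; last exact: below.
    case: v O => [c'|x] O /=; last by move/eqP => [->].
    have le_c'j : (c' <= j)%N by apply: below; apply/onthP; exists l.
    have neq_c' : c' != j by apply: contraNneq neq_l => <-; rewrite O.
    by case: ifP => // _ /eqP[->]; lia.
  have [/andP[rl ib]|nrl] := boolP ((inl j \in s.2) && (0 < i <= m)%N); last first.
    apply: leq_trans (same s None _ below) mono.
    by move=> h hh x; rewrite E => -[<-] /=; rewrite El (negbTE nrl).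
  pose J := Ordinal lt_jk.
  have lt_im : (i.-1 < m)%N by lia.
  (* Finding the next centre forces the value $i-1$ at [j], since queries count positions from 1. *)
  pose h1 := [ffun c => if c == J then Ordinal lt_im else h0 c].
  pose sc := (node_reveal s s.2 (inl j.+1)).
  pose sl := (node_reveal s s.2 (inr (j, i.-1))).
  have step h : hidden_oracle (hidden_at h) s (Neighbour l i Out) =
      if i.-1 == h J then sc else sl.
    rewrite /= El rl /= ib /= -[j in hidden_at _ j]/(val J) hidden_at_ord.
    by case: ifP.
  have -> : (k - j = (k - j.+1).+1)%N by lia.
  (* One binomial covers the [h] whose edge is at the queried position, the other those for which a
     leaf is found. *)
  rewrite binS addnC; apply: leq_trans (leq_add _ _).
  + apply: leq_trans (leq_card_setU _ _); apply/subset_leq_card/fintype.subsetP => h.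
    instantiate (1 := [set h : {ffun 'I_k -> 'I_m} | agree_below j h0 h &
      finds_centre (hidden_at h) alg q sl.1 (rcons hist sl.2)]).
    instantiate (1 := [set h : {ffun 'I_k -> 'I_m} | agree_below j.+1 h1 h &
      finds_centre (hidden_at h) alg q sc.1 (rcons hist sc.2)]).
    rewrite !inE [finds_centre _ _ q.+1 _ _]/= notk E step => /andP[hh].
    case: ifP => [/eqP ih|_] /= f; last by rewrite hh f orbT.
    rewrite f andbT; apply/orP; left; apply/agree_belowP => c lt_cj.
    rewrite ffunE; case: eqP => [->|/eqP neq_cJ]; first exact: val_inj.
    apply: (agree_belowP _ _ _ hh).
    by move: neq_cJ; rewrite -val_eqE /=; lia.
  + apply: IH => // c; rewrite /= mem_reveal => /orP[/eqP[->]//|/below]; lia.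
  + rewrite (_ : (k - j.+1).+1 = k - j)%N; last by lia.
    by apply: IH => // c; rewrite /= mem_reveal => /orP[//|/below].
pose t := node_reveal s [::] (inl 0%N).
apply: leq_trans (same t.1 t.2 _ _) mono; first by move=> h hh x; rewrite E => -[<-].
by move=> c; rewrite /= mem_reveal => /orP[/eqP[->]//|/below].
Qed.
End HiddenOracle.

Lemma index_map_in (T U : eqType) (g : T -> U) (s : seq T) x :
  {in x :: s &, injective g} -> index (g x) (map g s) = index x s.
Proof.
elim: s => //= y s IH g_inj.
rewrite (inj_in_eq g_inj) ?inE ?eqxx ?orbT // IH // => a b.
rewrite !inE => ax bx; apply: g_inj; rewrite !inE.
  by case/orP: ax => ->; rewrite ?orbT.
by case/orP: bx => ->; rewrite ?orbT.
Qed.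

(** * Simulation of the comet oracle by the hidden oracle *)

Section CometSimulation.
Variables (n K k : nat) (h : nat -> nat).
Hypotheses (K_gt0 : (0 < K)%N) (n_gt0 : (0 < n)%N) (K_dvd : (K %| n)%N).
Hypotheses (k_gt0 : (0 < k)%N) (le_kK : (k <= K)%N).
Local Notation m := (n %/ K)%N.
Hypothesis h_lt : forall i, (h i < m)%N.

Local Notation V := (comet_vertex n K).
Local Notation G := (comet n K).
Local Notation v1 := (centre1 n K_gt0).
Let hid i : 'I_m := Ordinal (h_lt i).

(** Position [h i] holds the next centre, and [unlift] numbers the other positions consecutively as
    the leaves. *)
Definition hidden_entry (i : 'I_K) (p : 'I_m) : V :=
  if unlift (hid i) p is Some j then inr (i, j) else inl (ordS i).

Definition hidden_adj (v : V) : seq V :=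
  if v is inl i then map (hidden_entry i) (enum 'I_m) else [:: v1].

Lemma hidden_entry_inj i : injective (hidden_entry i).
Proof.
move=> p p'; rewrite /hidden_entry.
by do 2![case: unliftP => [?|] ->] => // -[->].
Qed.

Lemma hidden_adjP : adjacency_lists G hidden_adj.
Proof.
case=> [i|x]; apply: uniq_perm; rewrite ?enum_uniq //.
- by rewrite map_inj_uniq ?enum_uniq //; exact: hidden_entry_inj.
- move=> v; rewrite mem_enum; apply/mapP/idP => [[p _ ->]|].
    rewrite /hidden_entry; case: (unlift _ _) => [j|]; exact: eqxx.
  case: v => [j|[l j]] /eqP ->.
    by exists (hid i); rewrite ?mem_enum // /hidden_entry unlift_none.
  by exists (lift (hid i) j); rewrite ?mem_enum // /hidden_entry liftK.
- by move=> [j|y]; rewrite mem_enum inE // -topredE /=; apply/eqP/eqP => [[->]//|j0];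
    congr inl; apply: val_inj.
Qed.

(** Defaults make the map total; its values matter on early nodes only. *)
Definition node_vertex (x : node) : V :=
  match x with
  | inl i => inl (insubd (Ordinal K_gt0) i)
  | inr (i, p) =>
      if insub p : option 'I_m is Some p' then
        hidden_entry (insubd (Ordinal K_gt0) i) p'
      else v1
  end.

(** These are the nodes that can be met before $v_{k+1}$; on them [node_vertex] is injective. *)
Definition early_node (x : node) : bool :=
  match x with
  | inl i => (i < k)%N
  | inr (i, p) => [&& (i < k)%N, (p < m)%N & p != h i]
  end.

Lemma val_insubd_early i : (i < k)%N -> val (insubd (Ordinal K_gt0) i) = i.
Proof. by move=> lt_ik; rewrite val_insubd (leq_trans lt_ik). Qed.

Lemma node_vertex_leaf i p : early_node (inr (i, p)) ->
  exists2 j, node_vertex (inr (i, p)) = inr (insubd (Ordinal K_gt0) i, j) &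
    p = bump (h i) j.
Proof.
case/and3P=> lt_ik lt_pm neq_p; rewrite /= insubT /hidden_entry /=.
case: unliftP => [j pE|pE]; first exists j => //.
  by move/(congr1 val): pE => /= ->; rewrite val_insubd_early.
by move/(congr1 val): pE neq_p => /= ->; rewrite val_insubd_early ?eqxx.
Qed.

Lemma node_vertex_inj : {in early_node &, injective node_vertex}.
Proof.
move=> [i|[i p]] [i'|[i' p']]; rewrite -!topredE => ex ex'.
- move=> [/(congr1 val)] /=; rewrite -!/(val _) !val_insubd_early // => ->; done.
- by have [j' -> _] := node_vertex_leaf ex'.
- by have [j -> _] := node_vertex_leaf ex.
- have [j -> pE] := node_vertex_leaf ex; have [j' -> pE'] := node_vertex_leaf ex'.
  case/and3P: ex => ik _ _; case/and3P: ex' => ik' _ _ [/(congr1 val) ii jj].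
  have {}ii : i = i' by rewrite -(val_insubd_early ik) ii val_insubd_early.
  by rewrite pE pE' jj ii.
Qed.

Lemma node_vertex_outdeg x : early_node x -> outdeg G (node_vertex x) = node_outdeg m x.
Proof.
case: x => [i|[i p]] ex; first by rewrite outdeg_centre.
by have [j -> _] := node_vertex_leaf ex; rewrite outdeg_leaf.
Qed.

Lemma node_vertex_next x p :
  early_node x -> (p < node_outdeg m x)%N -> early_node (node_next h x p) ->
  nth (node_vertex x) (hidden_adj (node_vertex x)) p = node_vertex (node_next h x p).
Proof.
case: x => [i|[i p']] ex lt_p ey; last first.
  have [j -> _] := node_vertex_leaf ex; move: lt_p; case: p ey => //= ey _.
  by congr inl; apply: val_inj; rewrite /= val_insubd_early.
rewrite /= (nth_map (Ordinal lt_p)) ?size_enum_ord //.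
rewrite (_ : nth _ _ p = Ordinal lt_p); last by apply: val_inj; rewrite /= nth_enum_ord.
move: ey; rewrite /node_next; case: eqP => [pE|_] ey; last by rewrite /= insubT.
rewrite /hidden_entry (_ : Ordinal lt_p = hid (insubd (Ordinal K_gt0) i)); last first.
  by apply: val_inj; rewrite /= val_insubd_early.
rewrite unlift_none /=; congr inl; apply: val_inj.
(* An early successor has $i+1 < k \le K$, so the modulus in [ordS] has no effect. *)
rewrite val_insubd_early // -[LHS]/(_ %% _)%N val_insubd_early // modn_small //.
exact: leq_trans ey le_kK.
Qed.

(** Revealed nodes are compared within the label table only, since the oracles test membership for
    no others. *)
Record simulates (s : seq node * seq node) (t : out_state V) : Prop := Simulates {
  sim_early : all early_node s.1;
  sim_labels : labels t = map node_vertex s.1;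
  sim_revealed : {in s.1, forall x, (node_vertex x \in revealed t) = (x \in s.2)}
}.

(** [B] and [r] are the revealed nodes kept before [u] is added: none for [Init], the present ones
    for a neighbour query. *)
Lemma simulates_reveal s t u r (B : {set V}) i :
  simulates s t -> early_node u ->
  {in s.1, forall x, (node_vertex x \in B) = (x \in r)} ->
  simulates (node_reveal m s r u).1
    (OutState (reveal (labels t) (node_vertex u)) (node_vertex u |: B)%SET i) /\
  reveal_answer G (labels t) (node_vertex u) = (node_reveal m s r u).2.
Proof.
move=> [early labE revE] eu BE.
have inj : {in rcons s.1 u &, injective node_vertex}.
  move=> x y xs ys; apply: node_vertex_inj; rewrite -topredE /=.
    by move: xs; rewrite mem_rcons inE => /orP[/eqP->//|/(allP early)].
  by move: ys; rewrite mem_rcons inE => /orP[/eqP->//|/(allP early)].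
have sub x : x \in reveal s.1 u -> x \in rcons s.1 u.
  by rewrite mem_reveal mem_rcons inE.
split; last first.
  rewrite /reveal_answer labE map_reveal // node_vertex_outdeg //=.
  rewrite index_map_in // => x y; rewrite !inE => xs ys; apply: inj.
    by case/orP: xs => [/eqP->|/sub//]; rewrite mem_rcons mem_head.
  by case/orP: ys => [/eqP->|/sub//]; rewrite mem_rcons mem_head.
split=> /=.
- by apply/allP => x; rewrite mem_reveal => /orP[/eqP->//|/(allP early)].
- by rewrite labE map_reveal.
- move=> x xs; rewrite in_setU1 inE (inj_in_eq inj (sub _ xs)) ?mem_rcons ?mem_head //.
  case: eqP => //= neq; apply: BE.
  by move: xs; rewrite mem_reveal => /orP[/eqP|].
Qed.

Lemma simulates_step s t x :
  simulates s t -> inl k \notin (hidden_oracle m h s x).1.1 ->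
  simulates (hidden_oracle m h s x).1
    (out_oracle G hidden_adj (fun=> v1) t x).1 /\
  (out_oracle G hidden_adj (fun=> v1) t x).2 = (hidden_oracle m h s x).2.
Proof.
move=> st; have [early labE revE] := st; case: x => [|l i []] //=.
  move=> _; have -> : v1 = node_vertex (inl 0%N).
    by congr inl; apply: val_inj; rewrite val_insubd_early.
  rewrite -[[set _]%SET]finset.setU0.
  by apply: simulates_reveal => // x _; rewrite !inE.
rewrite labE onth_map; case E : (onth s.1 l) => [v|] //=.
have vs : v \in s.1 by apply/onthP; exists l.
have ev := allP early _ vs.
rewrite revE // node_vertex_outdeg //; case: ifP => //= /andP[vr /andP[i0 id]] nk.
have lt_i : (i.-1 < node_outdeg m v)%N by rewrite prednK.
(* From an early node the only target that is not early is [inl k], which is excluded. *)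
have eu : early_node (node_next h v i.-1).
  case: v ev lt_i nk {E vs vr id} => [c|y] //= lt_ck lt_i.
  rewrite mem_reveal; case: (i.-1 =P h c) => [_|/eqP neq]; last by rewrite /= lt_ck lt_i.
  rewrite negb_or => /andP[/eqP neq_k _] /=.
  by rewrite ltn_neqAle lt_ck andbT; apply/eqP => ck; apply: neq_k; rewrite ck.
rewrite node_vertex_next // -labE.
exact: simulates_reveal.
Qed.

(** The right-hand side depends on the comet only through [m], so runs on both comets agree until
    $v_{k+1}$ is found. *)
Lemma simulates_run (alg : strategy query) q s t hist :
  simulates s t -> ~~ finds_centre m k h alg q s hist ->
  run (out_oracle G hidden_adj (fun=> v1)) alg q t hist =
  run (hidden_oracle m h) alg q s hist.
Proof.
elim: q s t hist => [|q IH] s t hist st /=; case: (alg hist) => // x.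
case Ho : (hidden_oracle m h s x) => [s' a].
case Oo : (out_oracle G hidden_adj (fun=> v1) t x) => [t' a'].
rewrite negb_or => /andP[_ nf].
have nk : inl k \notin s'.1 by case: (q) nf => [|?] /=; rewrite negb_or => /andP[].
have := @simulates_step s t x st; rewrite Ho Oo /= => /(_ nk) [st' ->].
exact: IH.
Qed.

Lemma simulates_init : simulates ([::], [::]) (OutState [::] finset.set0 0).
Proof. by split. Qed.
End CometSimulation.

(** * Averaging over the hidden positions *)

Lemma sum_measure_le (R : realType) (d : measure_display) (T : measurableType d)
    (mu : probability T R) (I : finType) (D : I -> set T) (N : nat) :
  (forall i, measurable (D i)) -> (forall w, #|[set i | `[< D i w >]]| <= N)%N ->
  (\sum_i mu (D i) <= N%:R%:E)%E.
Proof.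
move=> mD cardD.
(* The sum of the probabilities is the integral of the number of events containing [w]. *)
have -> : (\sum_i mu (D i) = \sum_i \int[mu]_(w in setT) (\1_(D i) w)%:E)%E.
  by apply: eq_bigr => i _; rewrite integral_indic // classical_sets.setIT.
pose f i : T -> \bar R := fun w => (\1_(D i) w)%:E.
have mf i : measurable_fun setT (f i).
  by apply/measurable_EFinP; exact: measurable_indic.
rewrite -(ge0_integral_sum _ _ mf) //; last by move=> i w _; rewrite lee_fin.
apply: (@le_trans _ _ (\int[mu]_(w in setT) (cst N%:R%:E w))%E); last first.
  by rewrite integral_cst // -[X in (_ * X)%E]/(mu setT) probability_setT mule1.
apply: ge0_le_integral => //.
- by move=> w _; apply: sume_ge0 => i _; rewrite lee_fin.
- exact: emeasurable_sum.
- move=> w _; rewrite sumEFin lee_fin.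
  rewrite (_ : \sum_i _ = \sum_i `[< D i w >]%:R); last first.
    apply: eq_bigr => i _; rewrite indicE.
    by have -> : (w \in D i) = `[< D i w >] by apply/idP/asboolP; rewrite in_setE.
  rewrite -natr_sum ler_nat.
  apply: leq_trans (cardD w); rewrite -sum1_card [leqRHS]big_mkcond.
  by apply: leq_sum => i _; rewrite !inE; case: asbool.
Qed.

(** Combines $\binom{q}{k} \le q^k/k!$ with $k^k/k! \le e^k$, a single term of the exponential
    series. *)
Lemma bin_le_expR (R : realType) (q k : nat) : (0 < k)%N ->
  'C(q, k)%:R <= (expR 1 * q%:R / k%:R) ^+ k :> R.
Proof.
move=> k_gt0; have k0 : 0 < k%:R :> R by rewrite ltr0n.
have f0 : 0 < k`!%:R :> R by rewrite ltr0n fact_gt0.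
have expk : k%:R ^+ k / k`!%:R <= expR 1 ^+ k :> R.
  rewrite -expRM_natr mul1r.
  have := @expR_ge1Dxn R k%:R k.-1 (ltW k0); rewrite prednK //; lra.
have binq : 'C(q, k)%:R * k`!%:R <= q%:R ^+ k :> R.
  rewrite -natrM -natrX ler_nat bin_ffact ffact_prod.
  rewrite -[X in (_ <= q ^ X)%N](card_ord k) -prod_nat_const.
  by apply: leq_prod => i _; exact: leq_subr.
rewrite -mulrA exprMn expr_div_n.
apply: (@le_trans _ _ (k%:R ^+ k / k`!%:R * (q%:R ^+ k / k%:R ^+ k))); last first.
  by rewrite ler_wpM2r // divr_ge0 ?exprn_ge0 // ltW.
rewrite [leRHS](_ : _ = q%:R ^+ k / k`!%:R); last first.
  by field; rewrite !gt_eqF ?exprn_gt0.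
by rewrite ler_pdivlMr.
Qed.

(** For each [h] both outputs are right with probability at least $2p-1$, and then $v_{k+1}$ is
    found; each seed finds it for at most ['C(q, k)] of the $m^k$ functions. *)
Lemma out_query_count (R : realType) (p : R) (n k : nat)
    (A : algorithm R query) (q : nat) :
  (0 < k)%N -> (0 < n)%N -> (k %| n)%N ->
  out_distinguishes (comet n k) (comet (2 * n) (2 * k)) p A q ->
  (2 * p - 1) * (n %/ k)%:R ^+ k <= 'C(q, k)%:R.
Proof.
move=> k0 n0 kn [succT succF].
have k20 : (0 < 2 * k)%N by rewrite muln_gt0.
have n20 : (0 < 2 * n)%N by rewrite muln_gt0.
have kn2 : (2 * k %| 2 * n)%N by rewrite dvdn_pmul2l.
have lek2 : (k <= 2 * k)%N by exact: leq_pmull.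
have m0 := quotient_gt0 k0 n0 kn.
pose H := {ffun 'I_k -> 'I_(n %/ k)}.
have hlt (h : H) i : (hidden_at h i < n %/ k)%N.
  by rewrite /hidden_at; case: insub => [j|]; rewrite ?ltn_ord.
have hlt2 (h : H) i : (hidden_at h i < 2 * n %/ (2 * k))%N.
  by rewrite divnMl // hlt.
pose T (h : H) := [set w | run (out_oracle (comet n k)
  (hidden_adj k0 (hlt h)) (fun=> centre1 n k0)) (strategy_of A w) q
  (OutState [::] finset.set0 0) [::] = Some true]%classic.
pose F (h : H) := [set w | run (out_oracle (comet (2 * n) (2 * k))
  (hidden_adj k20 (hlt2 h)) (fun=> centre1 (2 * n) k20)) (strategy_of A w) q
  (OutState [::] finset.set0 0) [::] = Some false]%classic.
have mT h : measurable (T h) by apply: measurable_run; exact: countable_query.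
have mF h : measurable (F h) by apply: measurable_run; exact: countable_query.
have pTF h : ((2 * p - 1)%:E <= seed_law A (T h `&` F h)%classic)%E.
  have pT : (p%:E <= seed_law A (T h))%E by apply: succT; exact: hidden_adjP.
  have pF : (p%:E <= seed_law A (F h))%E by apply: succF; exact: hidden_adjP.
  have le1 : (seed_law A (T h `|` F h)%classic <= 1)%E.
    by apply: probability_le1; exact: measurableU.
  have fin X : measurable X -> seed_law A X \is a fin_num.
    by move=> mX; rewrite fin_num_measure.
  rewrite measureUfinl // in le1; last by rewrite ltey_eq fin.
  have {}le1 : (seed_law A (T h) + seed_law A (F h) -
    seed_law A (T h `&` F h)%classic <= 1)%E by exact: le1.
  move: pT pF le1; rewrite -(fineK (fin _ (mT h))) -(fineK (fin _ (mF h))).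
  rewrite -(fineK (fin _ (measurableI _ _ (mT h) (mF h)))).
  rewrite -?EFinD -?EFinB !lee_fin; lra.
(* If $v_{k+1}$ is not found, both runs equal the run of the hidden oracle and cannot give different
   outputs. *)
have TFfind h w : (T h `&` F h)%classic w ->
    finds_centre (n %/ k) k (hidden_at h) (strategy_of A w) q ([::], [::]) [::].
  case=> rT rF; apply/negPn/negP => nf; move: rT rF; rewrite /T /F /mkset.
  rewrite (simulates_run n0 kn k0 (leqnn k) (simulates_init k k0 (hlt h)) nf).
  rewrite (simulates_run n20 kn2 k0 lek2 (simulates_init k k20 (hlt2 h))) ?divnMl //.
  by move=> ->.
have cardTF w : (#|[set h : H | `[< (T h `&` F h)%classic w >]]| <= 'C(q, k))%N.
  pose h0 : H := [ffun=> Ordinal m0].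
  have := @card_finds_centre (n %/ k) k (strategy_of A w) q 0 h0 ([::], [::]) [::].
  rewrite subn0 => /(_ isT) le_c; apply: leq_trans (le_c _) => //.
  apply/subset_leq_card/fintype.subsetP => h; rewrite finset.in_set => /asboolP TFw.
  by rewrite finset.in_set (TFfind _ _ TFw) andbT; apply/agree_belowP.
have := sum_measure_le (seed_law A) (fun h => measurableI _ _ (mT h) (mF h)) cardTF.
move=> le_sum; rewrite -lee_fin; apply: le_trans le_sum.
apply: (@le_trans _ _ (\sum_(h : H) (2 * p - 1)%:E)%E); last exact: lee_sum.
by rewrite sumEFin sumr_const card_ffun !card_ord lee_fin -[leRHS]mulr_natr natrX.
Qed.

Lemma out_query_bound (R : realType) (p : R) (n k : nat)
    (A : algorithm R query) (q : nat) :
  2^-1 < p -> (0 < k)%N -> (0 < n)%N -> (k %| n)%N ->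
  out_distinguishes (comet n k) (comet (2 * n) (2 * k)) p A q ->
  (2 * p - 1) / (2 * p) / expR 1 * n%:R <= q%:R.
Proof.
move=> p2 k0 n0 kn dis; have := out_query_count k0 n0 kn dis.
have nE : n%:R = (n %/ k)%:R * k%:R :> R by rewrite -natrM divnK.
have m0 : 0 < (n %/ k)%:R :> R by rewrite ltr0n quotient_gt0.
have k0' : 0 < k%:R :> R by rewrite ltr0n.
have e0 : 0 < expR 1 :> R by exact: expR_gt0.
rewrite nE; move: (_ %/ _)%N m0 => m m0 count.
rewrite leNgt; apply/negP => lt_q.
(* Here $0 < a \le 1$ and, since $2p>1$, $a < 2p-1$; so $q < an/e$ would give $(eq/k)^k \le a^k m^k
   \le a m^k < (2p-1) m^k$. *)
set a := (2 * p - 1) / (2 * p) in lt_q.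
have a0 : 0 < a by rewrite divr_gt0; lra.
have a1 : a <= 1 by rewrite ler_pdivrMr; lra.
have lt_aq : expR 1 * q%:R / k%:R <= a * m%:R.
  rewrite ler_pdivrMr // mulrC -ler_pdivlMr //.
  by rewrite [leRHS](_ : _ = a / expR 1 * (m%:R * k%:R)) ?ltW //; ring.
have := le_trans count (bin_le_expR R q k0).
have : (expR 1 * q%:R / k%:R) ^+ k <= (a * m%:R) ^+ k.
  apply: lerXn2r => //; rewrite nnegrE.
    by rewrite divr_ge0 // mulr_ge0 // ltW.
  by rewrite mulr_ge0 // ltW.
rewrite [X in _ <= X -> _]exprMn => h1 h2; have := le_trans h2 h1.
have mk : 0 < m%:R ^+ k :> R by rewrite exprn_gt0.
rewrite ler_pM2r //; apply/negP; rewrite -ltNge.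
apply: (@le_lt_trans _ _ a).
  by rewrite -{2}[a]expr1 ler_wiXn2l // ltW.
by rewrite ltr_pdivrMr; nra.
Qed.

Theorem theorem4 (R : realType) :
  (exists C : nat, forall n k : nat, (0 < k < n)%N -> (k %| n)%N ->
     (tmix R (comet n k) <= C%:R%:E)%E)
  /\ (forall n k : nat, (0 < k < n)%N -> (k %| n)%N ->
        (forall v1 : 'I_k, val v1 = 0%N ->
           eccentricity R (comet n k) (inl v1) = k%:R%:E)
        /\ diameter R (comet n k) = (if n == 2%N then k else k.+1)%:R%:E)
  /\ (forall p : R, 2^-1 < p ->
        exists c : R, 0 < c /\
          forall n k : nat, (0 < k)%N -> (0 < n)%N -> (k %| n)%N ->
          forall (A : algorithm R unit) (q : nat),
            pi_distinguishes (comet n k) (comet (2 * n) (2 * k)) p A q ->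
            c * (n%:R / k%:R) ^+ (k - 1) <= q%:R)
  /\ (forall p : R, 2^-1 < p ->
        exists c : R, 0 < c /\
          forall n k : nat, (0 < k)%N -> (0 < n)%N -> (k %| n)%N ->
          forall (A : algorithm R query) (q : nat),
            out_distinguishes (comet n k) (comet (2 * n) (2 * k)) p A q ->
            c * n%:R <= q%:R).
Proof.
(* A proper divisor gives $m \ge 2$, so every centre has a leaf. *)
have quo n k : (0 < k < n)%N -> (k %| n)%N -> (1 < n %/ k)%N.
  by move=> /andP[k0 kn] dv; rewrite ltn_divRL // mul1n.
split; [|split; [|split]].
- exists 16%N => n k kn dv; case/andP: (kn) => k0 lt_kn.
  exact: (comet_tmix R k0 (ltn_trans k0 lt_kn) dv (quo _ _ kn dv)).
- move=> n k kn dv; case/andP: (kn) => k0 _; have m1 := quo _ _ kn dv.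
  split=> [v1 v10|]; last exact: comet_diameter.
  rewrite (_ : v1 = Ordinal k0); first exact: comet_eccentricity.
  exact: val_inj.
- move=> p p2; have p0 : 0 < p by lra.
  have c0 : 0 < 2 - p^-1.
    by rewrite subr_gt0 -[ltRHS]invrK ltf_pV2 ?posrE //; lra.
  exists (2 - p^-1); split=> // n k k0 n0 dv A q dis.
  apply: le_trans (stationary_query_bound p0 k0 n0 dv dis).
  have -> : n%:R / k%:R = (n %/ k)%:R :> R.
    by rewrite -{1}(divnK dv) natrM mulfK // pnatr_eq0 -lt0n.
  (* The bound obtained has exponent $k$; as $m \ge 1$ it implies the one with $k-1$. *)
  rewrite ler_wpM2l ?(ltW c0) // ler_weXn2l ?leq_subr //.
  by rewrite ler1n quotient_gt0.
- move=> p p2; exists ((2 * p - 1) / (2 * p) / expR 1); split.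
    by rewrite !divr_gt0 ?expR_gt0 //; lra.
  by move=> n k k0 n0 dv A q; exact: out_query_bound.
Qed.
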